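(* Let $Q=Q^\top\in\mathbb{R}^{n\times n}$ be positive semidefinite and $R=R^\top\in\mathbb{R}^{m\times m}$ be positive definite. Then the data $(U_-,X)$ are informative for linear quadratic regulation if and only if at least one of the following two conditions holds: (i) The data $(U_-,X)$ are informative for system identification, that is, $\Sigma_{i/s}=\{(A_s,B_s)\}$, and the linear quadratic regulator problem is solvable for $(A_s,B_s,Q,R)$. In this case, the optimal feedback gain is $K=-(R+B_s^\top P^+B_s)^{-1}B_s^\top P^+A_s$, where $P^+$ is the largest real symmetric solution to $P=A_s^\top PA_s-A_s^\top PB_s(R+B_s^\top PB_s)^{-1}B_s^\top PA_s+Q$. (ii) For all $(A,B)\in\Sigma_{i/s}$ we have $A=A_s$. Moreover, $A_s$ is stable, $QA_s=0$, and the optimal feedback gain is given by $K=0$.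
   Context: Fix positive integers $n,m,q,T_1,\dots,T_q$. Let $(A_s,B_s)\in\mathbb{R}^{n\times n}\times\mathbb{R}^{n\times m}$ be the 'true' system $x(t+1)=A_sx(t)+B_su(t)$. For $i=1,\dots,q$ let $u^i(0),\dots,u^i(T_i-1)\in\mathbb{R}^m$ and $x^i(0),\dots,x^i(T_i)\in\mathbb{R}^n$ be input/state data generated by this system, i.e. $x^i(t+1)=A_sx^i(t)+B_su^i(t)$ for $t=0,\dots,T_i-1$. Put $U^i_-=[u^i(0)\ \cdots\ u^i(T_i-1)]$, $X^i=[x^i(0)\ \cdots\ x^i(T_i)]$, $X^i_-=[x^i(0)\ \cdots\ x^i(T_i-1)]$, $X^i_+=[x^i(1)\ \cdots\ x^i(T_i)]$, and $U_-=[U^1_-\ \cdots\ U^q_-]$, $X=[X^1\ \cdots\ X^q]$, $X_-=[X^1_-\ \cdots\ X^q_-]$, $X_+=[X^1_+\ \cdots\ X^q_+]$; thus $X_+=A_sX_-+B_sU_-$. The set of systems consistent with the data is $$\Sigma_{i/s}=\Big\{(A,B)\in\mathbb{R}^{n\times n}\times\mathbb{R}^{n\times m}\ \Big|\ X_+=\begin{bmatrix}A & B\end{bmatrix}\begin{bmatrix}X_- \\ U_- \end{bmatrix}\Big\}.$$ A square matrix is stable if all its eigenvalues lie in the open unit disk. LQR. For a system $x(t+1)=Ax(t)+Bu(t)$, let $x_{x_0,u}$ be the state sequence with $x(0)=x_0$ and input $u$, and let $J(x_0,u)=\sum_{t=0}^\infty x(t)^\top Qx(t)+u(t)^\top Ru(t)$.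 The LQR problem is solvable for $(A,B,Q,R)$ if for every $x_0$ there is an input $u^*$ with $J(x_0,u^* )<\infty$, $\lim_{t\to\infty}x_{x_0,u^*}(t)=0$, and $J(x_0,u^* )\le J(x_0,\bar u)$ for all $\bar u$ with $\lim_{t\to\infty}x_{x_0,\bar u}(t)=0$. Known facts (discrete-time LQR theory): if $(A,B)$ is stabilizable, the discrete-time algebraic Riccati equation $P=A^\top PA-A^\top PB(R+B^\top PB)^{-1}B^\top PA+Q$ has a unique largest real symmetric solution $P^+$ (i.e. $P^+\ge P$ for every real symmetric solution $P$), and $P^+\geq 0$; the LQR problem is solvable if and only if $(A,B)$ is stabilizable and every eigenvalue $\lambda$ of $A$ on the unit circle is $(Q,A)$-observable, i.e. $\operatorname{rank}\begin{bmatrix}A-\lambda I \\ Q \end{bmatrix}=n$; in that case the optimal input is unique for every $x_0$ and generated by $u=Kx$ with $K=-(R+B^\top P^+B)^{-1}B^\top P^+A$, and $A+BK$ is stable. This $K$ is called the optimal feedback gain for $(A,B,Q,R)$. Define $\Sigma_K^{Q,R}=\{(A,B)\mid$ the LQR problem is solvable for $(A,B,Q,R)$ and $K$ is the optimal feedback gain for $(A,B,Q,R)\}$. The data $(U_-,X)$ are informative for linear quadratic regulation (for given $Q,R$) if there exists $K$ with $\Sigma_{i/s}\subseteq\Sigma_K^{Q,R}$. *)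

(* Defs.v *)
(* The reals are an arbitrary [F : realType], as [R] is kept for the input weight
   of the quadratic cost. *)
From HB Require Import structures.
From mathcomp Require Export all_boot all_order all_algebra.
From mathcomp Require Export all_classical all_reals all_analysis.
From mathcomp Require Export complex.
Set Implicit Arguments.
Unset Strict Implicit.
Unset Printing Implicit Defensive.
Export Order.TTheory GRing.Theory Num.Theory.
Export numFieldNormedType.Exports.
Local Open Scope classical_set_scope.
Local Open Scope ring_scope.

Section Matrices.
Variable F : realType.

Definition mxquad k (S : 'M[F]_k) (v : 'cV[F]_k) : F := (v^T *m S *m v) 0 0.

Definition symmx k (S : 'M[F]_k) := S^T = S.

Definition psdmx k (S : 'M[F]_k) :=
  symmx S /\ forall v : 'cV[F]_k, 0 <= mxquad S v.

Definition pdmx k (S : 'M[F]_k) :=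
  symmx S /\ forall v : 'cV[F]_k, v != 0 -> 0 < mxquad S v.

Definition stablemx_dt k (A : 'M[F]_k) :=
  forall z : F[i], eigenvalue (map_mx (real_complex F) A) z -> `|z| < 1.

End Matrices.

Section LQR.
Variables (F : realType) (n m : nat).
Variables (A : 'M[F]_n) (B : 'M[F]_(n, m)) (Q : 'M[F]_n) (R : 'M[F]_m).

Fixpoint lti_state (x0 : 'cV[F]_n) (u : nat -> 'cV[F]_m) (t : nat) : 'cV[F]_n :=
  if t is s.+1 then A *m lti_state x0 u s + B *m u s else x0.

(* The limit of the partial sums in the extended reals; it always exists for
   [Q] positive semidefinite and [R] positive definite. *)
Definition lqr_cost (x0 : 'cV[F]_n) (u : nat -> 'cV[F]_m) : \bar F :=
  (\sum_(0 <= t <oo) (mxquad Q (lti_state x0 u t) + mxquad R (u t))%:E)%E.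

Definition lqr_solvable :=
  forall x0 : 'cV[F]_n, exists ustar : nat -> 'cV[F]_m,
    [/\ (lqr_cost x0 ustar < +oo)%E,
        lti_state x0 ustar @ \oo --> (0 : 'cV[F]_n)
      & forall ubar : nat -> 'cV[F]_m,
          lti_state x0 ubar @ \oo --> (0 : 'cV[F]_n) ->
          (lqr_cost x0 ustar <= lqr_cost x0 ubar)%E].

(* [invmx] is the identity on singular matrices, so the invertibility that the
   Riccati equation presupposes is stated explicitly. *)
Definition dare_solution (P : 'M[F]_n) :=
  [/\ symmx P, R + B^T *m P *m B \in unitmx
    & P = A^T *m P *m A
          - A^T *m P *m B *m invmx (R + B^T *m P *m B) *m B^T *m P *m A + Q].

Definition largest_dare_solution (P : 'M[F]_n) :=
  dare_solution P /\
  forall P' : 'M[F]_n, dare_solution P' -> psdmx (P - P').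

Definition lqr_gain (P : 'M[F]_n) : 'M[F]_(m, n) :=
  - (invmx (R + B^T *m P *m B) *m B^T *m P *m A).

Definition optimal_feedback_gain (K : 'M[F]_(m, n)) :=
  exists2 P, largest_dare_solution P & K = lqr_gain P.

End LQR.

Section Data.
Variables (F : realType) (n m q : nat) (T : 'I_q -> nat).
Variables (u : forall i : 'I_q, 'I_(T i) -> 'cV[F]_m)
          (x : forall i : 'I_q, 'I_(T i).+1 -> 'cV[F]_n).

(* [widen_ord (leqnSn _) t] is the time [t] and [lift ord0 t] the time [t + 1],
   for [t < T i]. *)
Definition generated_by (A : 'M[F]_n) (B : 'M[F]_(n, m)) :=
  forall (i : 'I_q) (t : 'I_(T i)),
    x (lift ord0 t) = A *m x (widen_ord (leqnSn _) t) + B *m u t.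

Definition Uminus : 'M[F]_(m, \sum_i T i) :=
  \mxrow_i \matrix_(a < m, t < T i) u t a 0.

Definition Xminus : 'M[F]_(n, \sum_i T i) :=
  \mxrow_i \matrix_(a < n, t < T i) x (widen_ord (leqnSn _) t) a 0.

Definition Xplus : 'M[F]_(n, \sum_i T i) :=
  \mxrow_i \matrix_(a < n, t < T i) x (lift ord0 t) a 0.

Definition Sigma_is : set ('M[F]_n * 'M[F]_(n, m)) :=
  [set AB | Xplus = row_mx AB.1 AB.2 *m col_mx Xminus Uminus].

Definition informative_sysid (As : 'M[F]_n) (Bs : 'M[F]_(n, m)) :=
  Sigma_is = [set (As, Bs)].

Definition Sigma_K (Q : 'M[F]_n) (R : 'M[F]_m) (K : 'M[F]_(m, n)) :
    set ('M[F]_n * 'M[F]_(n, m)) :=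
  [set AB | lqr_solvable AB.1 AB.2 Q R /\
            optimal_feedback_gain AB.1 AB.2 Q R K].

Definition informative_lqr (Q : 'M[F]_n) (R : 'M[F]_m) :=
  exists K : 'M[F]_(m, n), Sigma_is `<=` Sigma_K Q R K.

End Data.

(* Main.v *)
(* If the LQR problem is solvable, the parallelogram law makes optimal inputs
   depend linearly on the initial state, so the value function is a quadratic form
   [P]. Bellman's principle then shows that [P] solves the Riccati equation and that
   every optimal trajectory follows the gain of [P], which is therefore stabilizing;
   a stabilizing solution is the largest one.
   If two consistent systems differ by [(A0, B0)], then [(As + L A0, Bs + L B0)] is
   consistent for every [L]. A common gain [K] stabilizes all of these, which forces
   [A0 + B0 K = 0]. So the closed loop [M] is common, and with it the Lyapunov
   solution [P]; now [R K + B^T P M = 0] for every consistent [B] gives [P M = 0] as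
   soon as some [B0] is nonzero, whence [K = 0], [M = As], [P = Q] and [Q As = 0]. *)
Require Import Defs.
From mathcomp Require Import ring lra.
Set Implicit Arguments.
Unset Strict Implicit.
Unset Printing Implicit Defensive.
Local Open Scope classical_set_scope.
Local Open Scope ring_scope.

(** * Limits of matrices and spectral stability *)

Section MatrixLimits.
Variable F : realType.

Lemma mx_cvgP p q (u : nat -> 'M[F]_(p, q)) (L : 'M[F]_(p, q)) :
  u @ \oo --> L <-> forall i j, u t i j @[t --> \oo] --> L i j.
Proof.
split=> [uL i j|uL].
  exact: (cvg_comp _ _ uL (@coord_continuous _ _ _ i j L)).
move=> /= W [P LP PW].
have H : \forall t \near \oo, forall ij : 'I_p * 'I_q, P ij.1 ij.2 (u t ij.1 ij.2).
  by apply: filter_forall => -[i j]; apply: uL; apply: LP.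
by apply: filterS H => t Ht; apply: PW => i j; apply: (Ht (i, j)).
Qed.

Lemma cvg_mulmx p q r (u : nat -> 'M[F]_(p, q)) (w : nat -> 'M[F]_(q, r))
    (L : 'M[F]_(p, q)) (M : 'M[F]_(q, r)) :
  u @ \oo --> L -> w @ \oo --> M -> (u t *m w t) @[t --> \oo] --> L *m M.
Proof.
move=> /mx_cvgP uL /mx_cvgP wM; apply/mx_cvgP => i j; rewrite mxE.
rewrite (eq_cvg _ _ (fun t => mxE _ _ i j)).
by apply: cvg_big => [|k _]; [exact: add_continuous|apply: cvgM].
Qed.

Lemma cvg_mulmxl p q r (A : 'M[F]_(p, q)) (w : nat -> 'M[F]_(q, r))
    (M : 'M[F]_(q, r)) :
  w @ \oo --> M -> (A *m w t) @[t --> \oo] --> A *m M.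
Proof. by apply: cvg_mulmx; exact: cvg_cst. Qed.

Lemma cvg_mulmxr p q r (u : nat -> 'M[F]_(p, q))
    (L : 'M[F]_(p, q)) (A : 'M[F]_(q, r)) :
  u @ \oo --> L -> (u t *m A) @[t --> \oo] --> L *m A.
Proof. by move=> uL; apply: cvg_mulmx uL _; exact: cvg_cst. Qed.

Lemma cvg_trmx p q (u : nat -> 'M[F]_(p, q)) (L : 'M[F]_(p, q)) :
  u @ \oo --> L -> (u t)^T @[t --> \oo] --> L^T.
Proof.
move=> /mx_cvgP uL; apply/mx_cvgP => i j; rewrite mxE.
by rewrite (eq_cvg _ _ (fun t => mxE _ _ i j)).
Qed.


(** Once [b k] stays below [e / 2 * (1 - r)], unrolling the recursion bounds [a (k + N)] by
    [r ^+ k * a N + e / 2]. *)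
Lemma cvg0_contraction (r : F) (a b : nat -> F) :
    0 <= r < 1 -> (forall k, 0 <= a k) -> b @ \oo --> (0 : F) ->
    (forall k, a k.+1 <= r * a k + b k) -> a @ \oo --> (0 : F).
Proof.
move=> /andP[r0 r1] a0 b0 ab; apply/cvgr0Pnorm_le => e e0.
(* With this threshold, [e / 2] is the fixed point of [s |-> r * s + e / 2 * (1 - r)]. *)
have e'0 : 0 < e / 2 * (1 - r) by apply: mulr_gt0; lra.
have [N _ bN] := @cvgr0_norm_le _ _ _ _ _ _ b0 _ e'0.
have aN k : a (k + N)%N <= r ^+ k * a N + e / 2.
  elim: k => [|k IH]; first by rewrite add0n expr0 mul1r; lra.
  rewrite addSn; apply: le_trans (ab _) _.
  have := bN (k + N)%N (leq_addl _ _); rewrite ler_norml => /andP[_ bk].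
  have := ler_wpM2l r0 IH; rewrite exprS; lra.
have rk : (r ^+ k * a N) @[k --> \oo] --> (0 : F).
  rewrite -[X in _ --> X](mul0r (a N)); apply: cvgM; last exact: cvg_cst.
  by apply: cvg_expr; rewrite ger0_norm.
have e20 : 0 < e / 2 by lra.
have [N' _ rN'] := @cvgr0_norm_le _ _ _ _ _ _ rk _ e20.
exists (N' + N)%N => // k /= Nk.
rewrite ger0_norm //; have -> : k = (k - N + N)%N.
  by rewrite subnK // (leq_trans _ Nk) ?leq_addl.
apply: le_trans (aN _) _.
have /rN' : (N' <= k - N)%N by rewrite leq_subRL ?(leq_trans _ Nk) ?leq_addl // addnC.
by rewrite ler_norml => /andP[_]; lra.
Qed.

End MatrixLimits.

(** * Stability as convergence of the matrix powers to zero *)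

Section SpectralRadius.
Variable F : realType.
Local Notation toC := (map_mx (real_complex F)).

(* [Normc.normc] at the sort of the realType, where the topology is found. *)
Definition modc (z : F[i]) : F := Normc.normc z.

Lemma modc_ge0 (z : F[i]) : 0 <= modc z.
Proof. by case: z => a b /=; apply: sqrtr_ge0. Qed.

Lemma modc_real (x : F) : modc (x%:C)%C = `|x|.
Proof. by rewrite /modc /= expr0n addr0 sqrtr_sqr. Qed.

Lemma modc_lt1 (z : F[i]) : (`|z| < 1) = (modc z < 1).
Proof. by rewrite -ltcR. Qed.

Lemma modc_sum (I : finType) (f : I -> F[i]) :
  modc (\sum_i f i) <= \sum_i modc (f i).
Proof.
elim/big_ind2: _ => [|x a y b ? ?|//]; first by rewrite /modc Normc.normc0.
by apply: le_trans (le_normcD _ _) _; apply: lerD.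
Qed.

Lemma cvg0_modc_sum (I : finType) (f : nat -> I -> F[i]) :
  (forall i, modc (f k i) @[k --> \oo] --> (0 : F)) ->
  modc (\sum_i f k i) @[k --> \oo] --> (0 : F).
Proof.
move=> f0; have S0 : (\sum_i modc (f k i)) @[k --> \oo] --> (0 : F).
  have S0 : \sum_(i : I) (0 : F) = 0 by exact: big1.
  rewrite -[X in _ --> X]S0.
  by apply: cvg_big => [|i _]; [exact: add_continuous|exact: f0].
apply: squeeze_cvgr (cvg_cst 0) S0; near=> k.
by rewrite modc_ge0 modc_sum.
Unshelve. all: by end_near. Qed.

(** The linear factors are stripped off one at a time. If [h] is the product of the remaining
    factors, [y k = A ^+ k * h(A) * W] satisfies [y k.+1 = z *: y k + A ^+ k * ((A - z) * h(A)) *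
    W], whose last term tends to 0, so each entry contracts at rate [modc z]. No Jordan form is
    involved. *)
Lemma cvg0_exp_annihilated n (A W : 'M[F[i]]_n.+1) (r : seq F[i]) :
  (forall z, z \in r -> modc z < 1) ->
  (forall i j,
     modc ((A ^+ k * horner_mx A (\prod_(z <- r) ('X - z%:P)) * W) i j)
       @[k --> \oo] --> (0 : F)) ->
  forall i j, modc ((A ^+ k * W) i j) @[k --> \oo] --> (0 : F).
Proof.
elim: r W => [|z r IH] W rlt1 H.
  by move=> i j; have := H i j; rewrite big_nil rmorph1; under eq_cvg do rewrite mulr1.
apply: IH => [w wr|i j]; first by apply: rlt1; rewrite inE wr orbT.
set y := fun k => (A ^+ k * horner_mx A (\prod_(z <- r) ('X - z%:P)) * W).
have z1 : modc z < 1 by apply: rlt1; rewrite mem_head.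
apply: (@cvg0_contraction _ (modc z) _
   (fun k => modc ((A ^+ k * horner_mx A (\prod_(w <- z :: r) ('X - w%:P)) * W) i j))).
- by rewrite modc_ge0.
- by move=> k; exact: modc_ge0.
- exact: H.
move=> k; rewrite -[modc z * _]Normc.normcM; apply: le_trans (le_normcD _ _).
rewrite le_eqVlt; apply/orP; left; apply/eqP; congr modc.
rewrite big_cons rmorphM rmorphB /= horner_mx_X horner_mx_C.
set h := horner_mx A _.
have -> : A ^+ k.+1 * h * W = z *: (A ^+ k * h * W) + A ^+ k * ((A - z%:M) * h) * W.
  have zA : A ^+ k * z%:M = z%:M * A ^+ k by rewrite -!mulmxE scalar_mxC.
  by rewrite -mul_scalar_mx !mulmxE mulrBl mulrBr mulrBl !mulrA -exprSr zA addrC subrK.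
by rewrite mxE [X in X + _]mxE.
Qed.

(** Over [F[i]] the characteristic polynomial splits into factors whose roots are eigenvalues, and
    by Cayley-Hamilton it annihilates [M]. *)
Lemma stablemx_dt_expr_cvg0 n (M : 'M[F]_n) :
  stablemx_dt M -> (M ^+ k) @[k --> \oo] --> (0 : 'M[F]_n).
Proof.
case: n M => [|n] M Mst; apply/mx_cvgP => i j; first by case: i.
have [r Er] := closed_field_poly_normal (char_poly (toC M)).
rewrite (monicP (char_poly_monic _)) scale1r in Er.
have rlt1 z : z \in r -> modc z < 1.
  move=> zr; rewrite -modc_lt1; apply: Mst.
  by rewrite eigenvalue_root_char Er root_prod_XsubC.
rewrite mxE; apply/norm_cvg0P.
have := @cvg0_exp_annihilated _ (toC M) 1 r rlt1 _ i j.
rewrite -Er Cayley_Hamilton.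
under [X in _ -> X @ _ --> _]eq_fun do rewrite mulr1 -rmorphXn mxE modc_real.
apply=> a b; under eq_cvg do rewrite mulr0 mul0r mxE /modc Normc.normc0.
exact: cvg_cst.
Qed.

(** A left eigenvector [v] gives [v M^k = z^k v]; if [z] had modulus at least 1, a nonzero entry of
    [v] would never shrink. *)
Lemma expr_cvg0_stablemx_dt n (M : 'M[F]_n) :
  (M ^+ k) @[k --> \oo] --> (0 : 'M[F]_n) -> stablemx_dt M.
Proof.
case: n M => [|n] M M0 z /eigenvalueP[v vM v0].
  by move: v0; rewrite thinmx0 eqxx.
have [j vj] : exists j, v 0 j != 0 by apply/rV0Pn.
rewrite modc_lt1 ltNge; apply/negP => z1.
have vMk k : v *m toC (M ^+ k) = z ^+ k *: v.
  elim: k => [|k IH]; first by rewrite expr0 rmorph1 mulmx1 expr0 scale1r.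
  by rewrite exprSr rmorphM /= -mulmxE mulmxA IH -scalemxAl vM scalerA exprSr.
have vk : modc ((v *m toC (M ^+ k)) 0 j) @[k --> \oo] --> (0 : F).
  under eq_cvg do rewrite mxE.
  apply: cvg0_modc_sum => i.
  under eq_cvg do rewrite [modc _]Normc.normcM mxE [Normc.normc (_%:C)%C]modc_real.
  have /mx_cvgP/(_ i j) := M0; rewrite mxE => /cvg_norm; rewrite normr0 => Mij.
  by have := cvgM (cvg_cst (modc (v 0 i))) Mij; rewrite mulr0; apply.
have vj0 : 0 < modc (v 0 j).
  rewrite lt_neqAle modc_ge0 andbT eq_sym; apply: contra vj => /eqP.
  by move/Normc.eq0_normc ->.
have [N _ /(_ N (leqnn _))] := @cvgr0_norm_lt _ _ _ _ _ _ vk _ vj0.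
rewrite /= vMk mxE [modc _]Normc.normcM ger0_norm; last first.
  by apply: mulr_ge0; apply: modc_ge0.
rewrite ltNge => /negP; apply; rewrite ler_peMl ?modc_ge0 //.
elim: N => [|N IH]; first by rewrite expr0 Normc.normc1.
by rewrite exprS Normc.normcM; apply: mulr_ege1.
Qed.

End SpectralRadius.

(** * Quadratic forms and the Riccati equation *)

Section QuadraticForms.
Variable F : realType.

Lemma addmxE p q (S T : 'M[F]_(p, q)) i j : (S + T) i j = S i j + T i j.
Proof. by rewrite mxE. Qed.

Lemma oppmxE p q (S : 'M[F]_(p, q)) i j : (- S) i j = - S i j.
Proof. by rewrite mxE. Qed.

Lemma mxquad_addmx k (S T : 'M[F]_k) v : mxquad (S + T) v = mxquad S v + mxquad T v.
Proof. by rewrite /mxquad mulmxDr mulmxDl mxE. Qed.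

Lemma mxquad_oppmx k (S : 'M[F]_k) v : mxquad (- S) v = - mxquad S v.
Proof. by rewrite /mxquad mulmxN mulNmx mxE. Qed.

Lemma mxquad0 k (S : 'M[F]_k) : mxquad S 0 = 0.
Proof. by rewrite /mxquad mulmx0 mxE. Qed.

Lemma mxquad_congr k l (S : 'M[F]_k) (B : 'M[F]_(k, l)) v :
  mxquad (B^T *m S *m B) v = mxquad S (B *m v).
Proof. by rewrite /mxquad trmx_mul !mulmxA. Qed.

Lemma mxquadZ k (S : 'M[F]_k) (a : F) v : mxquad S (a *: v) = a ^+ 2 * mxquad S v.
Proof. by rewrite /mxquad -scalemxAr [(a *: v)^T]linearZ /= -!scalemxAl scalerA mxE expr2. Qed.

Lemma mxquadD k (S : 'M[F]_k) v w : symmx S ->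
  mxquad S (v + w) = mxquad S v + 2 * (w^T *m S *m v) 0 0 + mxquad S w.
Proof.
move=> Ssym; rewrite /mxquad [(v + w)^T]linearD /= mulmxDl mulmxDr !mulmxDl !addmxE.
have -> : (v^T *m S *m w) 0 0 = (w^T *m S *m v) 0 0.
  have <- : (v^T *m S *m w)^T = w^T *m S *m v by rewrite !trmx_mul trmxK Ssym mulmxA.
  by rewrite [RHS]mxE.
ring.
Qed.

Lemma mxquad_parallelogram k (S : 'M[F]_k) v w :
  mxquad S (v + w) + mxquad S (v - w) = 2 * mxquad S v + 2 * mxquad S w.
Proof.
rewrite /mxquad [(v + w)^T]linearD [(v - w)^T]linearB /= !mulmxDl !mulNmx !mulmxDr !mulmxN !(addmxE, oppmxE).
ring.
Qed.

Lemma symmxD k (S T : 'M[F]_k) : symmx S -> symmx T -> symmx (S + T).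
Proof. by rewrite /symmx linearD /= => -> ->. Qed.

Lemma symmx_congr k l (S : 'M[F]_k) (B : 'M[F]_(k, l)) :
  symmx S -> symmx (B^T *m S *m B).
Proof. by move=> Ssym; rewrite /symmx !trmx_mul Ssym trmxK mulmxA. Qed.

Lemma pdmx_unit k (S : 'M[F]_k) : pdmx S -> S \in unitmx.
Proof.
move=> [_ Spos]; rewrite unitmxE unitfE; apply/negP => /det0P[v v0 vS].
have := Spos v^T; rewrite /mxquad trmxK vS mul0mx mxE ltxx.
by rewrite -(trmx0 F 1 k) (inj_eq trmx_inj) => /(_ v0).
Qed.

Lemma pdmx_psdmx k (S : 'M[F]_k) : pdmx S -> psdmx S.
Proof.
move=> [Ssym Spos]; split=> // v; have [->|/Spos/ltW//] := eqVneq v 0.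
by rewrite /mxquad mulmx0 mxE.
Qed.

Lemma pdmx_add_congr k l (S : 'M[F]_k) (B : 'M[F]_(k, l)) (R : 'M[F]_l) :
  psdmx S -> pdmx R -> pdmx (R + B^T *m S *m B).
Proof.
move=> [Ssym Spos] [Rsym Rpos]; split.
  by rewrite /symmx linearD /= Rsym symmx_congr.
by move=> v v0; rewrite mxquad_addmx mxquad_congr ltr_wpDr ?Spos ?Rpos.
Qed.

(** The form of [S - T] vanishes, hence so do its entries by polarization on basis vectors. In
    particular a largest Riccati solution is unique. *)
Lemma psdmx_antisym k (S T : 'M[F]_k) : psdmx (S - T) -> psdmx (T - S) -> S = T.
Proof.
move=> [Dsym Dpos] [_ Dneg]; apply/eqP; rewrite -subr_eq0; apply/eqP.
set D := S - T in Dsym Dpos *.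
have D0 v : mxquad D v = 0.
  apply/eqP; rewrite eq_le Dpos andbT.
  by have := Dneg v; rewrite -opprB mxquad_oppmx oppr_ge0.
apply/matrixP => i j; rewrite [RHS]mxE.
have := mxquadD (delta_mx j 0) (delta_mx i 0) Dsym.
rewrite !D0 trmx_delta -rowE -colE !mxE.
lra.
Qed.

End QuadraticForms.

(** * Algebra of the Riccati equation and its largest solution *)

Section RiccatiAlgebra.
Variables (F : realType) (n m : nat).
Implicit Types (A P Q : 'M[F]_n) (B : 'M[F]_(n, m)) (R : 'M[F]_m) (K : 'M[F]_(m, n)).

(** The first-order condition, at [w = K x], for [mxquad R w + mxquad P (A x + B w)] as a function
    of [w]. *)
Lemma lqr_gain_stationary A B R P (K := lqr_gain A B R P) :
  R + B^T *m P *m B \in unitmx -> R *m K + B^T *m P *m (A + B *m K) = 0.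
Proof.
move=> Sunit; rewrite mulmxDr addrCA mulmxA -mulmxDl /K /lqr_gain mulmxN.
by rewrite !mulmxA mulmxV // mul1mx subrr.
Qed.

(** The Riccati equation and the gain formula are traded for two relations free of inverses;
    [costate_dare] is the way back. *)
Lemma dare_costate A B Q R P K : dare_solution A B Q R P -> K = lqr_gain A B R P ->
  R *m K + B^T *m P *m (A + B *m K) = 0 /\ P = A^T *m P *m (A + B *m K) + Q.
Proof.
move=> [Psym Sunit PE] KE; split; first by rewrite KE lqr_gain_stationary.
rewrite {1}PE KE /lqr_gain mulmxDr; congr (_ + _ + _).
by rewrite mulmxN mulmxN !mulmxA.
Qed.

Lemma costate_dare A B Q R P K : symmx P -> R + B^T *m P *m B \in unitmx ->
  R *m K + B^T *m P *m (A + B *m K) = 0 -> P = A^T *m P *m (A + B *m K) + Q ->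
  dare_solution A B Q R P /\ K = lqr_gain A B R P.
Proof.
move=> Psym Sunit K0 PE.
have KE : K = lqr_gain A B R P.
  rewrite /lqr_gain; apply: (can_inj (mulKmx Sunit)).
  rewrite mulmxN !mulmxA mulmxV // mul1mx; apply/eqP; rewrite -addr_eq0; apply/eqP.
  by rewrite -K0 [in RHS]mulmxDr mulmxDl !mulmxA -addrA [B^T *m P *m A + _]addrC.
split=> //; split=> //; rewrite {1}PE {1}KE /lqr_gain mulmxDr; congr (_ + _ + _).
by rewrite mulmxN mulmxN !mulmxA.
Qed.

(** Stationarity turns [K^T B^T P (A + B K)] into [- K^T R K]. The resulting equation is linear in
    [P] and sees the system only through [K] and the closed loop. *)
Lemma dare_lyapunov A B Q R P K : symmx R -> dare_solution A B Q R P ->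
  K = lqr_gain A B R P ->
  P = (A + B *m K)^T *m P *m (A + B *m K) + K^T *m R *m K + Q.
Proof.
move=> Rsym Pdare KE; have [/eqP K0 PE] := dare_costate Pdare KE.
have {K0} BP : B^T *m P *m (A + B *m K) = - (R *m K).
  by apply/eqP; rewrite -addr_eq0 addrC.
rewrite [(A + B *m K)^T]linearD /= trmx_mul !mulmxDl -[K^T *m B^T *m P]mulmxA -[K^T *m _ *m (A + _)]mulmxA BP.
by rewrite mulmxN mulmxA subrK.
Qed.

(** The difference [D] satisfies [D = (M^k)^T D M^k] for every [k], and the right side tends to
    0. *)
Lemma lyapunov_unique (M P1 P2 G : 'M[F]_n) : (M ^+ k) @[k --> \oo] --> (0 : 'M[F]_n) ->
  P1 = M^T *m P1 *m M + G -> P2 = M^T *m P2 *m M + G -> P1 = P2.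
Proof.
move=> M0 E1 E2; apply/eqP; rewrite -subr_eq0; apply/eqP.
set D := P1 - P2; have DE : D = M^T *m D *m M.
  by rewrite /D {1}E1 {1}E2 mulmxBr mulmxBl opprD addrACA subrr addr0.
have DkE k : (M ^+ k)^T *m D *m M ^+ k = D.
  elim: k => [|k IH]; first by rewrite expr0 trmx1 mul1mx mulmx1.
  by rewrite exprS -mulmxE trmx_mul !mulmxA -[_ *m M^T *m D]mulmxA -[_ *m (_ *m D) *m M]mulmxA -DE.
have := cvg_mulmx (cvg_mulmxr (A := D) (cvg_trmx M0)) M0.
under eq_cvg do rewrite DkE.
by rewrite mulmx0 => /(cvg_unique (@norm_hausdorff _ _) (cvg_cst D)).
Qed.

(** Writing [M] for the closed loop of [P], both [M^T P N - P] and [M^T P2 N - P2] equal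
    [- Q - K^T R K2], which gives the first identity. Substituting [M = N - B (K2 - K)] there gives
    the second. *)
Lemma dare_difference A B Q R P P2 K K2 : symmx Q -> symmx R ->
  dare_solution A B Q R P -> K = lqr_gain A B R P ->
  dare_solution A B Q R P2 -> K2 = lqr_gain A B R P2 ->
  let D := P - P2 in let N := A + B *m K2 in
  D = (A + B *m K)^T *m D *m N /\
  D = N^T *m D *m N - (K2 - K)^T *m (R + B^T *m P *m B) *m (K2 - K).
Proof.
move=> Qsym Rsym Pdare KE P2dare K2E D N.
have [[Psym _ _] [P2sym _ _]] := (Pdare, P2dare).
have [K0 PE] := dare_costate Pdare KE.
have [K20 P2E] := dare_costate P2dare K2E.
move: K0 K20; rewrite addrC => /eqP; rewrite addr_eq0 => /eqP BP.
rewrite addrC => /eqP; rewrite addr_eq0 => /eqP BP2.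
set M := A + B *m K in PE BP *; rewrite -/N in P2E BP2.
have MP : M^T *m P *m N = P - Q - K^T *m R *m K2.
  have PET : P = M^T *m P *m A + Q.
    by have := congr1 trmx PE; rewrite linearD /= !trmx_mul trmxK Psym Qsym mulmxA.
  have PBT : M^T *m P *m B = - (K^T *m R).
    have := congr1 trmx BP; by rewrite linearN /= !trmx_mul trmxK Psym Rsym !mulmxA.
  by rewrite /N mulmxDr mulmxA PBT mulNmx {2}PET addrK.
have MP2 : M^T *m P2 *m N = P2 - Q - K^T *m R *m K2.
  rewrite /M [(_ + _)^T]linearD /= trmx_mul !mulmxDl {3}P2E addrK; congr (_ + _).
  by rewrite -!mulmxA !mulmxA -[K^T *m B^T *m P2]mulmxA -[K^T *m _ *m N]mulmxA BP2 mulmxN mulmxA.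
have DE : D = M^T *m D *m N.
  by rewrite mulmxBr mulmxBl MP MP2 /D; apply/matrixP => i j; rewrite !mxE; ring.
split=> //.
have NE : N = M + B *m (K2 - K) by rewrite /N /M mulmxBr -addrA [B *m K + _]addrC subrK.
have BDN : B^T *m D *m N = (R + B^T *m P *m B) *m (K2 - K).
  rewrite mulmxBr mulmxBl BP2 {1}NE mulmxDr BP opprK mulmxDl [R *m (K2 - K)]mulmxBr.
  by rewrite mulmxA addrC addrA.
have ME : M = N - B *m (K2 - K) by rewrite NE addrK.
rewrite {1}DE {1}ME [(_ - _)^T]linearB /= trmx_mul !mulmxBl; congr (_ - _).
by rewrite -[RHS]mulmxA -BDN !mulmxA.
Qed.
(** The competitor [P2] need not be stabilizing, so powers of its closed loop [N] are of no help;
    [N] is instead run backwards, modulo the kernel of [D], where the stability of [M] takes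
    over. *)
Lemma stabilizing_dare_largest A B Q R P : psdmx Q -> pdmx R ->
  dare_solution A B Q R P -> pdmx (R + B^T *m P *m B) ->
  ((A + B *m lqr_gain A B R P) ^+ k) @[k --> \oo] --> (0 : 'M[F]_n) ->
  largest_dare_solution A B Q R P.
Proof.
move=> [Qsym _] [Rsym _] Pdare Spd M0; split=> // P2 P2dare.
have [DE1 DE2] := dare_difference Qsym Rsym Pdare erefl P2dare erefl.
set M := A + _ in M0 DE1; set D := P - P2 in DE1 DE2 *; set N := A + _ in DE1 DE2.
have Dsym : symmx D.
  by case: Pdare P2dare => [Ps _ _] [P2s _ _]; rewrite /symmx linearB /= Ps P2s.
(* [D = M^T D N] gives [D] and [D N] the same column space, hence [D N G = D];
   then [D >= G^T D G], iterated, and [D G^k = (M^k)^T D --> 0] yield [D >= 0]. *)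
have [G DG] : exists G, D *m N *m G = D.
  have /mxrank_leqif_sup/geq_leqif : ((D *m N)^T <= D^T)%MS by rewrite trmx_mul submxMl.
  rewrite !mxrank_tr {1}DE1 -mulmxA mxrankM_maxr => /esym/submxP[H HE].
  by exists H^T; apply: trmx_inj; rewrite trmx_mul trmxK.
have DGM : D *m G = M^T *m D by rewrite [in LHS]DE1 -!mulmxA [D *m _]mulmxA DG.
have DGk k : D *m G ^+ k = (M ^+ k)^T *m D.
  elim: k => [|k IH]; first by rewrite !expr0 trmx1 mul1mx mulmx1.
  by rewrite exprSr exprS -!mulmxE mulmxA IH -mulmxA DGM trmx_mul !mulmxA.
split=> // v.
(* The second identity of [dare_difference], evaluated at [G w], since [N G] preserves the form of
   [D]. *)
have Gle w : mxquad D (G *m w) <= mxquad D w.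
  have Dw : mxquad D (N *m (G *m w)) = mxquad D w.
    have DGT : G^T *m (N^T *m D) = D.
      by have := congr1 trmx DG; rewrite !trmx_mul Dsym.
    by rewrite -!mxquad_congr (mulmxA G^T) DGT DG.
  rewrite -Dw -[in leRHS]mxquad_congr {1}DE2 mxquad_addmx mxquad_oppmx mxquad_congr.
  by rewrite lerBlDr lerDl mxquad_congr; have [_] := pdmx_psdmx Spd; apply.
have Gkle k : mxquad D (G ^+ k *m v) <= mxquad D v.
  elim: k => [|k IH]; first by rewrite expr0 mul1mx.
  by rewrite exprS -mulmxE -mulmxA (le_trans (Gle _)).
(* Only [D G^k], not [G^k] itself, is known to tend to 0; the generalized inverse expresses the form
   through [D G^k v]. *)
have GkE k : mxquad D (G ^+ k *m v) = mxquad (pinvmx D) ((M ^+ k)^T *m D *m v).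
  have DpD : D^T *m pinvmx D *m D = D by rewrite Dsym mulmxKpV.
  by rewrite -DGk -mulmxA -[in RHS]mxquad_congr DpD.
have lim0 : mxquad (pinvmx D) ((M ^+ k)^T *m D *m v) @[k --> \oo] --> (0 : F).
  have H := cvg_mulmxr (A := D *m v) (cvg_trmx M0).
  have /mx_cvgP/(_ 0 0) := cvg_mulmx (cvg_mulmxr (A := pinvmx D) (cvg_trmx H)) H.
  rewrite trmx0 mul0mx mulmx0 mxE.
  by under [X in _ -> X @ _ --> _]eq_fun do rewrite -mulmxA.
apply: (ler_cvg_to lim0 (cvg_cst (mxquad D v))).
by near=> k; rewrite -GkE.
Unshelve. all: by end_near. Qed.

End RiccatiAlgebra.

(** * The value function *)

Section QuadraticLimit.
Variable F : realType.

Lemma symmx_mxquad_inj k (S T : 'M[F]_k) : symmx S -> symmx T ->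
  (forall v, mxquad S v = mxquad T v) -> S = T.
Proof.
move=> Ss Ts ST; apply: psdmx_antisym; split=> [|v].
- by rewrite /symmx linearB /= Ss Ts.
- by rewrite mxquad_addmx mxquad_oppmx ST subrr.
- by rewrite /symmx linearB /= Ss Ts.
- by rewrite mxquad_addmx mxquad_oppmx ST subrr.
Qed.

Lemma symmx_polarization k (S : 'M[F]_k) i j : symmx S ->
  S i j = (mxquad S (delta_mx i 0 + delta_mx j 0) - mxquad S (delta_mx i 0)
           - mxquad S (delta_mx j 0)) / 2.
Proof.
move=> Ss; rewrite addrC [delta_mx i 0 + _]addrC mxquadD //.
by rewrite trmx_delta -rowE -colE !mxE; field.
Qed.

(** By polarization, pointwise convergence of the forms forces convergence of the matrix entries. *)
Lemma mxquad_limit k (S : nat -> 'M[F]_k) (V : 'cV[F]_k -> F) :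
  (forall N, symmx (S N)) -> (forall x, mxquad (S N) x @[N --> \oo] --> V x) ->
  exists2 P, symmx P & forall x, V x = mxquad P x.
Proof.
move=> Ss SV.
pose P := \matrix_(i, j) ((V (delta_mx i 0 + delta_mx j 0) - V (delta_mx i 0)
   - V (delta_mx j 0)) / 2).
have SP : S @ \oo --> P.
  apply/mx_cvgP => i j; rewrite mxE.
  under eq_cvg do rewrite (symmx_polarization _ _ (Ss _)).
  by apply: cvgM; [apply: cvgB; [apply: cvgB|]; exact: SV|exact: cvg_cst].
exists P => [|x].
  by apply/matrixP => i j; rewrite !mxE addrC [V _ - _ - _]addrAC [delta_mx i 0 + _]addrC addrC.
apply: (cvg_unique (@norm_hausdorff _ _) (SV x)).
have /mx_cvgP := cvg_mulmxr (A := x) (cvg_mulmxl (A := x^T) SP).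
exact.
Qed.

End QuadraticLimit.

Section Trajectories.
Variables (F : realType) (n m : nat) (A : 'M[F]_n) (B : 'M[F]_(n, m)).
Implicit Types (x y : 'cV[F]_n) (u v : nat -> 'cV[F]_m).

Lemma lti_stateD x y u v t :
  lti_state A B (x + y) (fun t => u t + v t) t = lti_state A B x u t + lti_state A B y v t.
Proof.
elim: t => [//|t /= ->]; rewrite !mulmxDr.
by rewrite addrACA.
Qed.

Lemma lti_stateZ (c : F) x u t :
  lti_state A B (c *: x) (fun t => c *: u t) t = c *: lti_state A B x u t.
Proof. by elim: t => [//|t /= ->]; rewrite -!scalemxAr scalerDr. Qed.

Lemma lti_stateB x y u v t :
  lti_state A B (x - y) (fun t => u t - v t) t = lti_state A B x u t - lti_state A B y v t.
Proof.
elim: t => [//|t /= ->]; rewrite !mulmxBr.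
by rewrite opprD addrACA.
Qed.

Lemma lti_stateS x u t :
  lti_state A B x u t.+1 = lti_state A B (A *m x + B *m u 0%N) (fun t => u t.+1) t.
Proof. by elim: t => [//|t /= <-]. Qed.

Lemma lti_state_input0 x t : lti_state A B x (fun=> 0) t = A ^+ t *m x.
Proof.
elim: t => [|t /= ->]; first by rewrite mul1mx.
by rewrite mulmx0 addr0 exprS -mulmxE mulmxA.
Qed.

End Trajectories.

Section Cost.
Variables (F : realType) (n m : nat) (A : 'M[F]_n) (B : 'M[F]_(n, m)).
Variables (Q : 'M[F]_n) (R : 'M[F]_m).
Hypotheses (Q_psd : psdmx Q) (R_pd : pdmx R).
Implicit Types (x y : 'cV[F]_n) (u v : nat -> 'cV[F]_m).

Local Notation state := (lti_state A B).
Local Notation J := (lqr_cost A B Q R).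
Local Notation stage x u t := (mxquad Q (state x u t) + mxquad R (u t)).

Lemma stage_ge0 x u t : 0 <= stage x u t.
Proof.
by apply: addr_ge0; [case: Q_psd => _; apply|case: (pdmx_psdmx R_pd) => _; apply].
Qed.

Lemma stage_ge0E x u t : (0 <= (stage x u t)%:E)%E.
Proof. by rewrite lee_fin stage_ge0. Qed.

Lemma lqr_cost_ge0 x u : (0 <= J x u)%E.
Proof. by apply: nneseries_ge0 => t _ _; apply: stage_ge0E. Qed.

Lemma lqr_costS x u :
  J x u = ((stage x u 0)%:E + J (A *m x + B *m u 0%N) (fun t => u t.+1))%E.
Proof.
rewrite /lqr_cost nneseries_recl //; last by move=> t _; exact: stage_ge0E.
congr (_ + _)%E; rewrite -(@nneseries_addn _ _ 1); last by move=> t; exact: stage_ge0E.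
by apply: eq_eseriesr => t _; rewrite addn1 lti_stateS.
Qed.

Lemma lqr_cost_parallelogram x y u v :
  (J (x + y)%R (fun t => u t + v t)%R + J (x - y)%R (fun t => u t - v t)%R
   = 2%:E * J x u + 2%:E * J y v)%E.
Proof.
rewrite /lqr_cost -!nneseriesZl; try by move=> t _; exact: stage_ge0E.
rewrite -!nneseriesD; try by move=> t _ _; rewrite ?mule_ge0 ?stage_ge0E.
apply: eq_eseriesr => t _; rewrite lti_stateD lti_stateB -!EFinM -!EFinD; congr EFin.
rewrite addrACA !mxquad_parallelogram; ring.
Qed.

Lemma lqr_costZ (c : F) x u :
  J (c *: x) (fun t => c *: u t) = ((c ^+ 2)%:E * J x u)%E.
Proof.
rewrite /lqr_cost -nneseriesZl; last by move=> t _; exact: stage_ge0E.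
by apply: eq_eseriesr => t _; rewrite lti_stateZ -EFinM !mxquadZ mulrDr.
Qed.

Lemma lqr_cost_cvg x u (V : F) : J x u = V%:E ->
  (\sum_(0 <= t < N) stage x u t) @[N --> \oo] --> V.
Proof.
move=> JV.
have /cvg_ex[/= l H] : cvgn (fun N => \sum_(0 <= t < N) (stage x u t)%:E)%E.
  by apply: is_cvg_nneseries => t _ _; exact: stage_ge0E.
have E : l = V%:E.
  by rewrite -JV; apply/esym; apply: (cvg_lim _ H).
rewrite E in H.
rewrite (eq_cvg _ _ (_ : _ =1 fine \o (fun N => \sum_(0 <= t < N) (stage x u t)%:E)%E)).
  exact: fine_cvg.
by move=> N /=; rewrite sumEFin.
Qed.

Definition lqr_optimal x u :=
  [/\ (J x u < +oo)%E, state x u @ \oo --> (0 : 'cV[F]_n)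
    & forall v, state x v @ \oo --> (0 : 'cV[F]_n) -> (J x u <= J x v)%E].

Lemma admissibleD x y u v :
  state x u @ \oo --> (0 : 'cV[F]_n) -> state y v @ \oo --> (0 : 'cV[F]_n) ->
  state (x + y) (fun t => u t + v t) @ \oo --> (0 : 'cV[F]_n).
Proof.
move=> xu yv; rewrite (eq_cvg _ _ (lti_stateD _ _ _ _ _ _)) -[0]addr0; exact: cvgD.
Qed.

Lemma admissibleB x y u v :
  state x u @ \oo --> (0 : 'cV[F]_n) -> state y v @ \oo --> (0 : 'cV[F]_n) ->
  state (x - y) (fun t => u t - v t) @ \oo --> (0 : 'cV[F]_n).
Proof.
move=> xu yv; rewrite (eq_cvg _ _ (lti_stateB _ _ _ _ _ _)) -[0]subr0; exact: cvgB.
Qed.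

Lemma admissibleZ (c : F) x u : state x u @ \oo --> (0 : 'cV[F]_n) ->
  state (c *: x) (fun t => c *: u t) @ \oo --> (0 : 'cV[F]_n).
Proof.
move=> xu; rewrite (eq_cvg _ _ (lti_stateZ _ _ _ _ _)) -(scaler0 _ c).
by apply: cvgZ => //; exact: cvg_cst.
Qed.

Lemma lqr_optimalZ (c : F) x u : lqr_optimal x u -> lqr_optimal (c *: x) (fun t => c *: u t).
Proof.
move=> [Jfin xu xuopt]; split; [|exact: admissibleZ|].
  by rewrite lqr_costZ; move: Jfin (lqr_cost_ge0 x u); case: (J x u) => //= r _ _; rewrite -EFinM ltry.
move=> v cxv; rewrite lqr_costZ; have [->|c0] := eqVneq c 0.
  by rewrite expr0n mul0e lqr_cost_ge0.
(* A competitor at [c *: x] is rescaled by [c^-1] into a competitor at [x]. *)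
have -> : J (c *: x) v = ((c ^+ 2)%:E * J x (fun t => (c^-1 *: v t)%R))%E.
  rewrite -lqr_costZ; congr lqr_cost; apply/funext => t.
  by rewrite scalerA divff // scale1r.
apply: lee_pmul => //; rewrite ?lee_fin ?sqr_ge0 ?lqr_cost_ge0 //.
apply: xuopt; have := admissibleZ c^-1 cxv.
by rewrite scalerA mulVf // scale1r.
Qed.

(* With [w] optimal for [x - y] and [a] a competitor for [x + y], the
   parallelogram law and the optimality of [2 u] and [2 v] at [2 x] and [2 y] give
   [J(x+y,a) + J(x-y,w) >= J(x+y,u+v) + J(x-y,u-v) >= J(x+y,u+v) + J(x-y,w)]. *)
Lemma lqr_optimalD x y u v : lqr_solvable A B Q R ->
  lqr_optimal x u -> lqr_optimal y v -> lqr_optimal (x + y) (fun t => u t + v t).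
Proof.
move=> solv xu yv; have [Ju xu0 _] := xu; have [Jv yv0 _] := yv.
have [w [Jw w0 wopt]] := solv (x - y).
have fin (z : 'cV[F]_n) a : (J z a < +oo)%E -> J z a \is a fin_num.
  by move=> Ja; rewrite ge0_fin_numE ?lqr_cost_ge0.
have Juv := lqr_cost_parallelogram x y u v.
have Juvfin : (J (x + y)%R (fun t => u t + v t)%R < +oo)%E.
  apply: (@le_lt_trans _ _ (2%:E * J x u + 2%:E * J y v)%E).
    by rewrite -Juv leeDl ?lqr_cost_ge0.
  by rewrite -ge0_fin_numE ?adde_ge0 ?mule_ge0 ?lqr_cost_ge0 // fin_numD !fin_numM ?fin.
split=> // [|a a0]; first exact: admissibleD.
have := lqr_cost_parallelogram (x + y) (x - y) a w.
have -> : x + y + (x - y) = 2 *: x by rewrite addrACA subrr addr0 scaler_nat mulr2n.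
have -> : x + y - (x - y) = 2 *: y by rewrite opprB [x + y]addrC addrACA subrr addr0 scaler_nat mulr2n.
move=> Ja.
have [_ _ /(_ (fun t => a t + w t)) H1] := lqr_optimalZ 2 xu.
have [_ _ /(_ (fun t => a t - w t)) H2] := lqr_optimalZ 2 yv.
have {}H1 : (J (2 *: x) (fun t => (2 *: u t)%R) <= J (2 *: x) (fun t => (a t + w t)%R))%E.
  apply: H1; have := admissibleD a0 w0.
  by rewrite addrACA subrr addr0 scaler_nat mulr2n.
have {}H2 : (J (2 *: y) (fun t => (2 *: v t)%R) <= J (2 *: y) (fun t => (a t - w t)%R))%E.
  apply: H2; have := admissibleB a0 w0.
  by rewrite opprB [x + y]addrC addrACA subrr addr0 scaler_nat mulr2n.
rewrite !lqr_costZ in H1 H2.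
have H3 := wopt _ (admissibleB xu0 yv0).
have := leeD H1 H2; rewrite {}Ja => {H1 H2}.
(* Against a competitor of finite cost all the costs involved are finite, which leaves real linear
   arithmetic. *)
have [->|afin] := eqVneq (J (x + y) a) +oo%E; first by rewrite leey.
have {afin}: J (x + y)%R a \is a fin_num.
  by rewrite ge0_fin_numE ?lqr_cost_ge0 // lt_neqAle afin leey.
move: Juv H3 Juvfin; move: (fin _ _ Ju) (fin _ _ Jv) (fin _ _ Jw).
move: (lqr_cost_ge0 (x - y) (fun t => u t - v t)).
case: (J x u) => // ju; case: (J y v) => // jv; case: (J _ w) => // jw.
case: (J _ a) => // ja.
case: (J _ (fun t => u t + v t)) => // js; case: (J _ (fun t => u t - v t)) => // jd.
rewrite -!EFinM -!EFinD !lee_fin => _ _ _ _ [E] H3 _ H; lra.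
Qed.

Lemma lqr_optimal_sum (I : Type) (s : seq I) (c : I -> F) (x : I -> 'cV[F]_n)
    (u : I -> nat -> 'cV[F]_m) : lqr_solvable A B Q R ->
  (forall i, lqr_optimal (x i) (u i)) ->
  lqr_optimal (\sum_(i <- s) c i *: x i) (fun t => \sum_(i <- s) c i *: u i t).
Proof.
move=> solv opt; elim: s => [|i s IH].
  (* The empty sum is [0 *: w] for an optimal [w] at 0, so homogeneity shows that the zero input is
     optimal there. *)
  have [w wopt] := solv 0.
  have -> : (fun t => \sum_(i <- [::]) c i *: u i t) = (fun t => 0 *: w t).
    by apply/funext => t; rewrite big_nil scale0r.
  by rewrite big_nil; have := lqr_optimalZ 0 wopt; rewrite scale0r.
have -> : (fun t => \sum_(j <- i :: s) c j *: u j t)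
    = (fun t => c i *: u i t + \sum_(j <- s) c j *: u j t).
  by apply/funext => t; rewrite big_cons.
by rewrite big_cons; exact: lqr_optimalD solv (lqr_optimalZ (c i) (opt i)) IH.
Qed.

(** The columns of [U t] are optimal inputs from the basis vectors. By linearity [U t *m x] is
    optimal from [x], with state [X t *m x], so the partial costs are quadratic forms [S N] in [x]
    and the value is their limit. *)
Lemma lqr_value_quadratic : lqr_solvable A B Q R ->
  exists2 P : 'M[F]_n, psdmx P &
    forall x u, lqr_optimal x u -> J x u = (mxquad P x)%:E.
Proof.
move=> solv.
have /choice[u uopt] : forall i : 'I_n, exists u, lqr_optimal (delta_mx i 0) u.
  by move=> i; have [u] := solv (delta_mx i 0); exists u.
pose U t : 'M[F]_(m, n) := \matrix_(a, i) u i t a 0.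
have UxE x : (fun t => U t *m x) = (fun t => \sum_i x i 0 *: u i t).
  apply/funext => t; apply/colP => a; rewrite mxE summxE.
  by apply: eq_bigr => i _; rewrite !mxE mulrC.
have Uopt x : lqr_optimal x (fun t => U t *m x).
  rewrite UxE {1}(matrix_sum_delta x).
  under eq_bigr do rewrite big_ord1.
  exact: lqr_optimal_sum.
pose X := fix X t : 'M[F]_n := if t is s.+1 then A *m X s + B *m U s else 1%:M.
have XE x t : state x (fun t => U t *m x) t = X t *m x.
  elim: t => [|t /= ->]; first by rewrite mul1mx.
  by rewrite mulmxDl !mulmxA.
pose S N := \sum_(0 <= t < N) ((X t)^T *m Q *m X t + (U t)^T *m R *m U t).
have SE N x : mxquad (S N) x = \sum_(0 <= t < N) stage x (fun t => U t *m x) t.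
  rewrite /S; elim: N => [|N IH]; first by rewrite !big_geq // /mxquad mulmx0 mul0mx mxE.
  by rewrite !big_nat_recr //= mxquad_addmx IH mxquad_addmx !mxquad_congr XE.
have Ssym N : symmx (S N).
  rewrite /symmx /S linear_sum; apply: eq_bigr => t _.
  by rewrite linearD /= !symmx_congr //; [case: R_pd|case: Q_psd].
have JE x : J x (fun t => U t *m x) = (fine (J x (fun t => U t *m x)))%:E.
  by rewrite fineK // ge0_fin_numE ?lqr_cost_ge0 //; have [] := Uopt x.
have [] := @mxquad_limit _ _ S (fun x => fine (J x (fun t => U t *m x))) Ssym.
  by move=> x; under eq_cvg do rewrite SE; apply: lqr_cost_cvg (JE x).
move=> P Psym PE; exists P => [|x v [_ xv xvopt]].
  by split=> // x; rewrite -PE fine_ge0 ?lqr_cost_ge0.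
rewrite -PE -JE; have [_ xU xUopt] := Uopt x.
by apply/eqP; rewrite eq_le xvopt // xUopt.
Qed.

End Cost.

(** * Bellman's principle and the stabilizing Riccati solution *)

Section DynamicProgramming.
Variables (F : realType) (n m : nat) (A : 'M[F]_n) (B : 'M[F]_(n, m)).
Variables (Q : 'M[F]_n) (R : 'M[F]_m).
Hypotheses (Q_psd : psdmx Q) (R_pd : pdmx R).

Local Notation state := (lti_state A B).
Local Notation J := (lqr_cost A B Q R).

(** Expanding around [w = K x], the cross term is a multiple of the stationarity expression and
    vanishes. *)
Lemma bellman_complete_square (P : 'M[F]_n) (K : 'M[F]_(m, n)) x w : symmx P ->
  R *m K + B^T *m P *m (A + B *m K) = 0 ->
  mxquad R w + mxquad P (A *m x + B *m w) =
    mxquad R (K *m x) + mxquad P ((A + B *m K) *m x)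
    + mxquad (R + B^T *m P *m B) (w - K *m x).
Proof.
move=> Psym K0; have [Rsym _] := R_pd.
have [d ->] : exists d, w = K *m x + d by exists (w - K *m x); rewrite addrC subrK.
rewrite [_ + d - _]addrAC subrr add0r.
have -> : A *m x + B *m (K *m x + d) = (A + B *m K) *m x + B *m d.
  by rewrite mulmxDr mulmxDl addrA mulmxA.
rewrite !mxquadD // mxquad_addmx mxquad_congr.
have : (d^T *m R *m (K *m x)) 0 0 + ((B *m d)^T *m P *m ((A + B *m K) *m x)) 0 0 = 0.
  rewrite -addmxE; have -> : d^T *m R *m (K *m x) + (B *m d)^T *m P *m ((A + B *m K) *m x)
      = d^T *m (R *m K + B^T *m P *m (A + B *m K)) *m x.
    by rewrite trmx_mul mulmxDr mulmxDl !mulmxA.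
  by rewrite K0 mulmx0 mul0mx mxE.
lra.
Qed.

Lemma lqr_solvable_dare : lqr_solvable A B Q R ->
  exists P : 'M[F]_n, [/\ dare_solution A B Q R P,
    pdmx (R + B^T *m P *m B) &
    ((A + B *m lqr_gain A B R P) ^+ k) @[k --> \oo] --> (0 : 'M[F]_n)].
Proof.
move=> solv; have [P P_psd JP] := lqr_value_quadratic Q_psd R_pd solv.
have [[Psym Ppos] [Qsym _] [Rsym _]] := And3 P_psd Q_psd R_pd.
have Spd := pdmx_add_congr B P_psd R_pd; have Sunit := pdmx_unit Spd.
set K := lqr_gain A B R P; have K0 : R *m K + _ = 0 := lqr_gain_stationary A Sunit.
set M := A + B *m K in K0 *.
have square x w := bellman_complete_square x w Psym K0.
exists P; rewrite -/K -/M.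
(* The competitor plays [w] first and then an optimal input from the state reached. *)
have bellman x w : mxquad P x <= mxquad Q x + mxquad R w + mxquad P (A *m x + B *m w).
  have [u xu] := solv x; have [_ _ umin] := xu.
  have [v yv] := solv (A *m x + B *m w); have [_ v0 _] := yv.
  pose a t := if t is s.+1 then v s else w.
  have a0 : state x a @ \oo --> (0 : 'cV[F]_n).
    by rewrite -cvg_shiftS /= (eq_cvg _ _ (fun t => lti_stateS _ _ _ _ t)).
  have := umin _ a0; rewrite (JP _ _ xu) lqr_costS // (JP _ _ yv).
  by rewrite -EFinD lee_fin.
have optimal_step x u : lqr_optimal A B Q R x u ->
    u 0%N = K *m x /\ lqr_optimal A B Q R (M *m x) (fun t => u t.+1).
  move=> xu; have [_ xu0 _] := xu.
  have tail0 : state (A *m x + B *m u 0%N) (fun t => u t.+1) @ \oo --> (0 : 'cV[F]_n).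
    by move: xu0; rewrite -cvg_shiftS /= (eq_cvg _ _ (fun t => lti_stateS _ _ _ _ t)).
  have [v vopt] := solv (A *m x + B *m u 0%N); have [_ _ /(_ _ tail0)] := vopt.
  have := JP _ _ xu; rewrite lqr_costS // (JP _ _ vopt) /=.
  case E : (J _ (fun t => u t.+1)) => [r| |] //; rewrite -EFinD lee_fin => -[xuE] vr.
  have := square x (u 0%N); have := square x (K *m x).
  have := bellman x (K *m x); have := bellman x (u 0%N).
  rewrite subrr mxquad0 addr0.
  rewrite mulmxA -mulmxDl -/M => b1 b2 _ sq.
  (* The tail costs at least the value at the next state, so [bellman] at [K x] and the completed
     square leave a nonpositive form of [R + B^T P B] at this difference. *)
  have d0 : u 0%N - K *m x = 0.
    apply/eqP; apply: contraT => d0; have [_ /(_ _ d0)] := Spd; lra.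
  move/eqP: (d0); rewrite subr_eq0 => /eqP uK; split=> //.
  move: tail0 E vopt vr; rewrite uK mulmxA -mulmxDl -/M => tail0 E vopt vr.
  have [_ _ vmin] := vopt.
  split=> // [|a /vmin]; first by rewrite E ltry.
  apply: le_trans; rewrite E (JP _ _ vopt) lee_fin.
  by move: xuE; rewrite uK; lra.
(* Along an optimal input Bellman's inequality is an equality, and every [x] starts such an
   input. *)
have PE : P = Q + K^T *m R *m K + M^T *m P *m M.
  apply: symmx_mxquad_inj => // [|x].
    by apply: symmxD; [apply: symmxD => //|]; exact: symmx_congr.
  rewrite !mxquad_addmx !mxquad_congr.
  have [u xu] := solv x; have [uK Mopt] := optimal_step _ _ xu.
  have := JP _ _ xu; rewrite lqr_costS // uK mulmxA -mulmxDl -/M (JP _ _ Mopt) /=.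
  by rewrite -EFinD => -[<-].
split=> //.
- have [] := @costate_dare _ _ _ A B Q R P K Psym Sunit K0 _ => //.
  rewrite {1}PE -addrA addrC; congr (_ + Q); move/eqP: K0; rewrite addr_eq0 => /eqP RK.
  have MT : M^T = A^T + K^T *m B^T by rewrite /M linearD /= trmx_mul.
  by rewrite -mulmxA RK mulmxN MT !mulmxDl !mulmxA addrC addrK.
apply/mx_cvgP => i j.
have [u xu] := solv (delta_mx j 0).
(* Hence column [j] of [M ^+ t] is the optimal trajectory from the [j]-th basis vector, which tends
   to 0. *)
have ME t x v : lqr_optimal A B Q R x v -> state x v t = M ^+ t *m x.
  elim: t x v => [|t IH] x v xv; first by rewrite mul1mx.
  have [vK Mopt] := optimal_step _ _ xv.
  rewrite lti_stateS vK mulmxA -mulmxDl -/M (IH _ _ Mopt).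
  by rewrite exprSr -mulmxE mulmxA.
have [_ /mx_cvgP/(_ i 0)] := xu.
under eq_cvg do rewrite (ME _ _ _ xu) -colE mxE.
by rewrite !mxE.
Qed.

End DynamicProgramming.

(** * Systems consistent with the data *)

Section OptimalGain.
Variables (F : realType) (n m : nat) (A : 'M[F]_n) (B : 'M[F]_(n, m)).
Variables (Q : 'M[F]_n) (R : 'M[F]_m).
Hypotheses (Q_psd : psdmx Q) (R_pd : pdmx R).

Lemma lqr_solvable_largest_dare : lqr_solvable A B Q R ->
  exists2 P : 'M[F]_n, largest_dare_solution A B Q R P &
    ((A + B *m lqr_gain A B R P) ^+ k) @[k --> \oo] --> (0 : 'M[F]_n).
Proof.
move=> /(lqr_solvable_dare Q_psd R_pd)[P [Pdare Spd M0]]; exists P => //.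
exact: stabilizing_dare_largest.
Qed.

(** The largest solution that defines [K] coincides, by antisymmetry, with the stabilizing one
    supplied by solvability. *)
Lemma optimal_gain_dare K : lqr_solvable A B Q R -> optimal_feedback_gain A B Q R K ->
  exists P : 'M[F]_n, [/\ dare_solution A B Q R P, K = lqr_gain A B R P &
    ((A + B *m K) ^+ k) @[k --> \oo] --> (0 : 'M[F]_n)].
Proof.
move=> /lqr_solvable_largest_dare[P [Pdare Pmax] M0] [P' [P'dare P'max] ->].
have -> : P' = P by apply: psdmx_antisym; [exact: P'max|exact: Pmax].
by exists P.
Qed.

(** Under the zero input only the initial state is charged, and every input pays at least
    [mxquad Q x] at time 0. Accordingly [Q] itself solves the Riccati equation, with gain 0. *)
Lemma lqr_zero_gain : stablemx_dt A -> Q *m A = 0 ->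
  lqr_solvable A B Q R /\ optimal_feedback_gain A B Q R 0.
Proof.
move=> /stablemx_dt_expr_cvg0 A0 QA0; have [Qsym Qpos] := Q_psd.
split=> [x|].
  have QAt t y : mxquad Q (A ^+ t *m (A *m y)) = 0.
    by rewrite mulmxA mulmxE -exprSr exprS -mulmxE /mxquad -!mulmxA (mulmxA Q) QA0 mul0mx mulmx0 mxE.
  have J0 : lqr_cost A B Q R x (fun=> 0) = (mxquad Q x)%:E.
    rewrite lqr_costS // mulmx0 addr0 mxquad0 addr0 [X in (_ + X)%E](_ : _ = 0%E) ?adde0 //.
    by apply: eseries0 => t _ _; rewrite lti_state_input0 QAt mxquad0 addr0.
  exists (fun=> 0); split.
  - by rewrite J0 ltry.
  - rewrite (eq_cvg _ _ (lti_state_input0 _ _ _)) -(mul0mx _ x).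
    exact: cvg_mulmxr.
  - move=> v _; rewrite J0 lqr_costS // -[leLHS]adde0; apply: leeD.
      by rewrite lee_fin lerDl; have [_] := pdmx_psdmx R_pd; apply.
    exact: lqr_cost_ge0.
have S_unit : R + B^T *m Q *m B \in unitmx by apply/pdmx_unit/pdmx_add_congr.
have [|| Qdare gain0] := @costate_dare _ _ _ A B Q R Q 0 Qsym S_unit.
- by rewrite !mulmx0 addr0 add0r -mulmxA QA0 mulmx0.
- by rewrite mulmx0 addr0 -mulmxA QA0 mulmx0 add0r.
exists Q => //; apply: stabilizing_dare_largest => //.
  exact: pdmx_add_congr.
by rewrite -gain0 mulmx0 addr0.
Qed.

End OptimalGain.

Lemma exists_mulmx_eq (F : realType) p q (y : 'cV[F]_p) (w : 'cV[F]_q) :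
  y != 0 -> exists L : 'M[F]_(q, p), L *m y = w.
Proof.
move=> /cV0Pn[i yi]; exists (w *m ((y i 0)^-1 *: delta_mx 0 i)).
rewrite -mulmxA -scalemxAl -rowE [row i y]mx11_scalar mxE scale_scalar_mx.
by rewrite mulVf // mulmx1.
Qed.

(** * Consequences of a gain common to all consistent systems *)

Section Data.
Variables (F : realType) (n m q : nat) (T : 'I_q -> nat).
Variables (As : 'M[F]_n) (Bs : 'M[F]_(n, m)).
Variables (u : forall i : 'I_q, 'I_(T i) -> 'cV[F]_m)
          (x : forall i : 'I_q, 'I_(T i).+1 -> 'cV[F]_n).
Hypothesis data_ux : generated_by u x As Bs.

Lemma Sigma_isP A B :
  Sigma_is u x (A, B) <-> Xplus x = A *m Xminus x + B *m Uminus u.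
Proof. by rewrite /Sigma_is /= mul_row_col. Qed.

Lemma Sigma_is_true_system : Sigma_is u x (As, Bs).
Proof.
apply/Sigma_isP; rewrite /Xplus /Xminus /Uminus !mul_mxrow -mxrowD.
apply: eq_mxrow => i; apply/matrixP => a t; rewrite !mxE data_ux !mxE.
by congr (_ + _); apply: eq_bigr => k _; rewrite mxE.
Qed.

(** The difference of two consistent systems annihilates the data, and so does any left multiple of
    it. *)
Lemma Sigma_is_affine A B L : Sigma_is u x (A, B) ->
  Sigma_is u x (As + L *m (A - As), Bs + L *m (B - Bs)).
Proof.
move=> /Sigma_isP AB; have /Sigma_isP ABs := Sigma_is_true_system.
apply/Sigma_isP; rewrite !mulmxDl addrACA -ABs -!mulmxA -mulmxDr !mulmxBl.
by rewrite addrACA -opprD -AB -ABs subrr mulmx0 addr0.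
Qed.

Section Informative.
Variables (Q : 'M[F]_n) (R : 'M[F]_m) (K : 'M[F]_(m, n)).
Hypotheses (Q_psd : psdmx Q) (R_pd : pdmx R).
Hypothesis Sigma_sub : Sigma_is u x `<=` Sigma_K Q R K.

Let gain_dare A B : Sigma_is u x (A, B) ->
  exists P : 'M[F]_n, [/\ dare_solution A B Q R P, K = lqr_gain A B R P &
    ((A + B *m K) ^+ k) @[k --> \oo] --> (0 : 'M[F]_n)].
Proof. by move=> /Sigma_sub[]; exact: optimal_gain_dare. Qed.

(* Otherwise some [L] puts the eigenvalue 1 in the closed loop of the consistent
   system [(As + L (A - As), Bs + L (B - Bs))]. *)
Lemma informative_closed_loop A B : Sigma_is u x (A, B) -> A + B *m K = As + Bs *m K.
Proof.
move=> AB; set M := As + _; pose W := A - As + (B - Bs) *m K.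
suff W0 : W = 0.
  by apply/eqP; rewrite -subr_eq0 -W0 /W mulmxBl opprD addrACA.
apply/matrixP => i j; rewrite [RHS]mxE; apply: contrapT => Wij.
pose v : 'cV[F]_n := delta_mx j 0.
have Wv : W *m v != 0.
  by apply/cV0Pn; exists i; rewrite -colE mxE; apply/eqP.
have [L LWv] := exists_mulmx_eq (v - M *m v) Wv.
have [P [_ _]] := gain_dare (Sigma_is_affine L AB).
have -> : As + L *m (A - As) + (Bs + L *m (B - Bs)) *m K = M + L *m W.
  by rewrite mulmxDl addrACA -mulmxA -mulmxDr.
move=> M0; have fixv k : (M + L *m W) ^+ k *m v = v.
  elim: k => [|k IH]; first by rewrite mul1mx.
  by rewrite exprSr -mulmxE -mulmxA mulmxDl -[L *m W *m v]mulmxA LWv [M *m v + _]addrC subrK.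
have := cvg_mulmxr (A := v) M0; under eq_cvg do rewrite fixv.
rewrite mul0mx => /(cvg_unique (@norm_hausdorff _ _) (cvg_cst v)) v0.
by move: Wv; rewrite v0 mulmx0 eqxx.
Qed.

(** The cases are split on whether [Bs] is the only consistent input matrix; if it is, the common
    closed loop determines [A] as well. *)
Lemma informative_dichotomy :
  (forall A B, Sigma_is u x (A, B) -> A = As /\ B = Bs) \/
  [/\ K = 0, forall A B, Sigma_is u x (A, B) -> A = As,
      stablemx_dt As & Q *m As = 0].
Proof.
have [P [Pdare KP M0]] := gain_dare Sigma_is_true_system.
have [_ Rsym] := (Q_psd.1, R_pd.1).
have stationary A B : Sigma_is u x (A, B) -> R *m K + B^T *m P *m (As + Bs *m K) = 0.
  move=> AB; have [P1 [P1dare KP1 _]] := gain_dare AB.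
  have ABK := informative_closed_loop AB.
  have [K0 _] := dare_costate P1dare KP1; rewrite ABK in K0.
  (* Both solve the Lyapunov equation of the common closed loop with the same [K]. *)
  suff -> : P = P1 by [].
  apply: (lyapunov_unique M0 (G := K^T *m R *m K + Q)); rewrite addrA.
    exact: dare_lyapunov.
  by rewrite -ABK; exact: dare_lyapunov.
have [unique|] := pselect (forall A B, Sigma_is u x (A, B) -> B = Bs).
  left=> A B AB; have BE := unique _ _ AB; split=> //.
  by have := informative_closed_loop AB; rewrite BE => /addIr.
move=> /existsNP[A /existsNP[B /not_implyP[AB /eqP BBs]]]; right.
set M := As + Bs *m K in M0 stationary.
have PM : P *m M = 0.
  have [i [j Bij]] : exists i j, (B - Bs) i j != 0.
    apply: contrapT => H; move/eqP: BBs; apply; apply/eqP; rewrite -subr_eq0.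
    apply/eqP/matrixP => i j; rewrite [RHS]mxE; apply: contrapT => /eqP Bij.
    by apply: H; exists i, j.
  have y0 : (B - Bs) *m delta_mx j (0 : 'I_1) != 0.
    by apply/cV0Pn; exists i; rewrite -colE mxE.
  apply/row_matrixP => k; rewrite row0.
  (* Subtracting the stationarity conditions for [Bs + L (B - Bs)] and [Bs] gives
     [(L (B - Bs))^T P M = 0]. This [L] sends column [j] of [B - Bs] to the [k]-th basis vector, so
     row [j] of the identity is row [k] of [P M]. *)
  have [L LE] := exists_mulmx_eq (delta_mx k 0) y0.
  have := stationary _ _ (Sigma_is_affine L AB).
  rewrite [(Bs + _)^T]linearD /= !mulmxDl addrA (stationary _ _ Sigma_is_true_system) add0r.
  move=> /(congr1 (mulmx (delta_mx j (0 : 'I_1))^T)).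
  by rewrite !mulmxA -trmx_mul -(mulmxA L) LE mulmx0 trmx_delta -mulmxA -rowE.
have K0 : K = 0.
  have := stationary _ _ Sigma_is_true_system; rewrite -mulmxA PM mulmx0 addr0.
  by move=> /(congr1 (mulmx (invmx R))); rewrite mulmx0 mulKmx ?pdmx_unit.
have MAs : M = As by rewrite /M K0 mulmx0 addr0.
split=> //.
- by move=> A' B' /informative_closed_loop; rewrite -/M MAs K0 mulmx0 addr0.
- by apply: expr_cvg0_stablemx_dt; rewrite -MAs.
(* With [K = 0] and [P M = 0] this equation reduces to [P = Q], so [Q As] is [P M]. *)
have PQ := dare_lyapunov Rsym Pdare KP.
rewrite -/M -(mulmxA M^T) PM K0 !mulmx0 !add0r in PQ.
by rewrite -PQ -MAs.
Qed.

End Informative.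
End Data.

(** The last two conjuncts carry the claims on the gain in cases (i) and (ii): each exhibits one
    gain that is optimal for every consistent system. *)
Theorem theorem26 (F : realType) (n m q : nat) (T : 'I_q -> nat)
  (n_gt0 : (0 < n)%N) (m_gt0 : (0 < m)%N) (q_gt0 : (0 < q)%N)
  (T_gt0 : forall i, (0 < T i)%N)
  (As : 'M[F]_n) (Bs : 'M[F]_(n, m))
  (u : forall i : 'I_q, 'I_(T i) -> 'cV[F]_m)
  (x : forall i : 'I_q, 'I_(T i).+1 -> 'cV[F]_n)
  (data_ux : generated_by u x As Bs)
  (Q : 'M[F]_n) (R : 'M[F]_m) (Q_psd : psdmx Q) (R_pd : pdmx R) :
  [/\ informative_lqr u x Q R <->
        (informative_sysid u x As Bs /\ lqr_solvable As Bs Q R)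
        \/ [/\ forall A B, Sigma_is u x (A, B) -> A = As,
               stablemx_dt As,
               Q *m As = 0
             & forall A B, Sigma_is u x (A, B) ->
                 optimal_feedback_gain A B Q R 0],
      informative_sysid u x As Bs -> lqr_solvable As Bs Q R ->
        exists2 P, largest_dare_solution As Bs Q R P
          & Sigma_is u x `<=` Sigma_K Q R (lqr_gain As Bs R P)
    & (forall A B, Sigma_is u x (A, B) -> A = As) ->
      stablemx_dt As -> Q *m As = 0 ->
        Sigma_is u x `<=` Sigma_K Q R 0].
Proof.
have sysid : informative_sysid u x As Bs -> lqr_solvable As Bs Q R ->
    exists2 P, largest_dare_solution As Bs Q R P
      & Sigma_is u x `<=` Sigma_K Q R (lqr_gain As Bs R P).
  move=> ident solv; have [P Pmax _] := lqr_solvable_largest_dare Q_psd R_pd solv.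
  by exists P => // AB; rewrite ident => ->; split=> //; exists P.
have zero : (forall A B, Sigma_is u x (A, B) -> A = As) ->
    stablemx_dt As -> Q *m As = 0 -> Sigma_is u x `<=` Sigma_K Q R 0.
  by move=> AAs st QAs [A B] /AAs ->; exact: lqr_zero_gain.
split=> //; split=> [[K sub]|[[ident solv]|[AAs st QAs _]]].
- have true_sys := Sigma_is_true_system data_ux.
  have [unique|[K0 AAs st QAs]] := informative_dichotomy data_ux Q_psd R_pd sub.
    left; split; last by case: (sub _ true_sys).
    by apply/seteqP; split=> [[A B] /unique[-> ->]|_ ->].
  by right; split=> // A B /sub[_]; rewrite K0.
- by have [P _ sub] := sysid ident solv; exists (lqr_gain As Bs R P).
- by exists 0; exact: zero.
Qed.
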